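(* Let $m\in\mathbb{Z}_{>0}$ and write $m=2^lk$ with $k$ an odd number and $l\in\mathbb{Z}_{\ge0}$. Then the dihedral quandle $R_m$ is decomposed into $2^l$ maximal connected subquandles (that is, its maximal connected subquandle decomposition consists of exactly $2^l$ maximal connected subquandles), every maximal connected subquandle of $R_m$ is isomorphic to $R_k$, and $\mathrm{depth}(R_m)=l$.
   Context: A quandle is a non-empty set $X$ with a binary operation $*$ such that (i) $a*a=a$ for all $a$; (ii) for every $a\in X$ the map $S_a:X\to X$, $S_a(x)=x*a$, is a bijection; (iii) $(a*b)*c=(a*c)*(b*c)$ for all $a,b,c$. A quandle isomorphism is a bijection preserving $*$. A subquandle is a non-empty subset that is itself a quandle under $*$. The dihedral quandle $R_m$ is the set $\mathbb{Z}/m\mathbb{Z}$ with $a*b=2b-a$. The inner automorphism group $\mathrm{Inn}(X)$ is the group of bijections of $X$ generated by $\{S_a\mid a\in X\}$; $\mathrm{Orb}_X(a)$ denotes the orbit of $a$ under $\mathrm{Inn}(X)$ (orbits are subquandles). A quandle $X$ is connected if $\mathrm{Inn}(X)$ acts transitively on $X$. A connected subquandle of $X$ is a subquandle which is connected as a quandle in its own right. A connected subquandle $A$ of $X$ is a maximal connected subquandle of $X$ if the only connected subquandle of $X$ including $A$ is $A$ itself. $X=\bigsqcup_{i\in I}A_i$ is called the maximal connected subquandle decomposition of $X$ when each $A_i$ is a maximal connected subquandle of $X$ (every quandle has exactly one such decomposition). For a set $\mathcal{A}$ of subquandles of $X$, define $D(\mathcal{A}):=\bigcup_{A\in\mathcal{A}}\{\mathrm{Orb}_A(a)\mid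 a\in A\}$, and put $D^0(\mathcal{A}):=\mathcal{A}$, $D^{k+1}(\mathcal{A}):=D(D^k(\mathcal{A}))$. The number $\mathrm{depth}(X)$ is the minimal $n\in\mathbb{Z}_{\ge0}$ such that $X=\bigsqcup_{A\in D^n(\{X\})}A$ is the maximal connected subquandle decomposition of $X$. *)

(* Defs.v *)
From HB Require Import structures.
From mathcomp Require Import all_boot all_algebra.
From mathcomp Require Import boolp classical_sets functions cardinality.

Set Implicit Arguments.
Unset Strict Implicit.
Unset Printing Implicit Defensive.

Import GRing.Theory.
Local Open Scope classical_set_scope.

HB.mixin Record isQuandle X := {
  qop : X -> X -> X;
  quandle_nonempty : inhabited X;
  qop_idem : forall a, qop a a = a;
  qop_bij : forall a, bijective (qop^~ a);
  qop_distr : forall a b c, qop (qop a b) c = qop (qop a c) (qop b c)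
}.

#[short(type="quandleType")]
HB.structure Definition Quandle := { X of isQuandle X }.

Declare Scope quandle_scope.
Delimit Scope quandle_scope with quandle.
Notation "a * b" := (qop a b) : quandle_scope.
Local Open Scope quandle_scope.

Definition right_translation (X : quandleType) (a x : X) : X := x * a.

Definition quandle_isomorphic (X Y : quandleType) : Prop :=
  exists2 f : X -> Y, bijective f & {morph f : x y / x * y}.

(* The subgroup generated by the right translations in the group of all
   bijections of X. *)
Inductive Inn (X : quandleType) : set (X -> X) :=
| Inn_gen a : Inn (right_translation a)
| Inn_id : Inn id
| Inn_comp f g : Inn f -> Inn g -> Inn (f \o g)
| Inn_inv f g : Inn f -> cancel f g -> cancel g f -> Inn g.

Definition Orb (X : quandleType) (a : X) : set X :=
  [set f a | f in @Inn X].

Definition connected_quandle (X : quandleType) : Prop :=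
  forall x y : X, exists2 f, Inn f & f x = y.

(* Axioms (i) and (iii) are inherited by every subset; what is left is
   non-emptiness and that right_translation a restricts to a bijection of A for
   each a in A, which includes closure of A under the operation. *)
Record subquandle (X : quandleType) := Subquandle {
  subquandle_set :> set X;
  subquandle_nonempty : subquandle_set !=set0;
  subquandle_bij : forall a, subquandle_set a ->
    set_bij subquandle_set subquandle_set (right_translation a)
}.

Section SubquandleAsQuandle.
Variables (X : quandleType) (A : subquandle X).

Fact sub_qop_subproof (x a : A) : val x * val a \in (A : set X).
Proof.
have [homoA _ _] := subquandle_bij (set_mem (valP a)).
by apply: mem_set; apply: homoA; apply: set_mem (valP x).
Qed.

Definition sub_qop (x a : A) : A := Sub (val x * val a) (sub_qop_subproof x a).

Fact sub_nonempty : inhabited A.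
Proof. by have [x Ax] := subquandle_nonempty A; exists; exists x; apply: mem_set. Qed.

Fact sub_qop_idem a : sub_qop a a = a.
Proof. by apply: val_inj; apply: qop_idem. Qed.

Fact sub_qop_bij a : bijective (sub_qop^~ a).
Proof.
have [_ injA surjA] := subquandle_bij (set_mem (valP a)).
have inv y : {x | sub_qop x a = y}.
  apply: cid; have [x Ax xE] := surjA _ (set_mem (valP y)).
  by exists (Sub x (mem_set Ax)); apply: val_inj.
exists (fun y => sval (inv y)) => [x|y]; last by case: (inv y).
apply: val_inj; apply: injA; do ?exact: (valP _).
by case: (inv _) => z /= /(congr1 val).
Qed.

Fact sub_qop_distr a b c :
  sub_qop (sub_qop a b) c = sub_qop (sub_qop a c) (sub_qop b c).
Proof. by apply: val_inj; apply: qop_distr. Qed.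

HB.instance Definition _ := isQuandle.Build (set_type A)
  sub_nonempty sub_qop_idem sub_qop_bij sub_qop_distr.

End SubquandleAsQuandle.

Section FullSubquandle.
Variable X : quandleType.

Fact full_nonempty : [set: X] !=set0.
Proof. by have [x] := @quandle_nonempty X; exists x. Qed.

Fact full_bij (a : X) : [set: X] a -> set_bij [set: X] [set: X] (right_translation a).
Proof.
move=> _; have [g gK Kg] := qop_bij a; split=> //.
- by move=> x y _ _; apply: (can_inj gK).
- by move=> y _; exists (g y) => //; apply: Kg.
Qed.

Definition full_subquandle : subquandle X := Subquandle full_nonempty full_bij.

End FullSubquandle.

Section OrbitSubquandle.
Variables (X : quandleType) (A : subquandle X) (a : A).

Definition Orb_in : set X := [set val b | b in Orb a].

Fact Orb_in_nonempty : Orb_in !=set0.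
Proof. by exists (val a), a => //; exists id => //; apply: Inn_id. Qed.

Fact Orb_in_bij c : Orb_in c -> set_bij Orb_in Orb_in (right_translation c).
Proof.
move=> [b _ <-]; have [g gK Kg] := qop_bij b; split.
- move=> _ [x [f If fax] <-]; exists (x * b) => //.
  exists (right_translation b \o f); last by rewrite /= fax.
  by apply: Inn_comp => //; apply: Inn_gen.
- move=> _ _ /set_mem [x _ <-] /set_mem [y _ <-] xy.
  by congr val; apply: (can_inj gK); apply: val_inj.
- move=> _ [y [f If fay] <-]; exists (val (g y)); last first.
    by rewrite -[in RHS](Kg y).
  exists (g y) => //; exists (g \o f); last by rewrite /= fay.
  by apply: Inn_comp => //; apply: Inn_inv (Inn_gen b) _ _.
Qed.

Definition orbit_subquandle : subquandle X :=
  Subquandle Orb_in_nonempty Orb_in_bij.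

End OrbitSubquandle.

Definition maximal_connected (X : quandleType) (A : subquandle X) : Prop :=
  connected_quandle A /\
  forall B : subquandle X, connected_quandle B -> A `<=` B -> B = A.

Definition maximal_connected_decomposition (X : quandleType)
    (F : set (subquandle X)) : Prop :=
  [/\ forall A, F A -> maximal_connected A,
      trivIset F (@subquandle_set X)
    & \bigcup_(A in F) (A : set X) = [set: X]].

Definition orbits (X : quandleType) (F : set (subquandle X)) :
    set (subquandle X) :=
  \bigcup_(A in F) range (fun a : A => orbit_subquandle a).

Definition orbits_iter (X : quandleType) (n : nat) : set (subquandle X) :=
  iter n (@orbits X) [set full_subquandle X].

Arguments orbits_iter X n : clear implicits.

(* A relation rather than a function, since a quandle may have no finite
   depth. *)
Definition has_depth (X : quandleType) (n : nat) : Prop :=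
  maximal_connected_decomposition (orbits_iter X n) /\
  forall p, maximal_connected_decomposition (orbits_iter X p) -> n <= p.

(* Z/mZ for m > 0 is 'I_m with its canonical additive group structure, which is
   only inferred on types of the form 'I_n.+1; hence m.-1.+1, equal to m for
   m > 0. The value at m = 0 is irrelevant. *)
Definition dihedral (m : nat) : Type := 'I_m.-1.+1.

Section Dihedral.
Variable m : nat.

Definition dihedral_op (a b : 'I_m.-1.+1) : 'I_m.-1.+1 := (b *+ 2 - a)%R.

Fact dihedral_nonempty : inhabited 'I_m.-1.+1.
Proof. by exists; apply: ord0. Qed.

Fact dihedral_idem a : dihedral_op a a = a.
Proof. by rewrite /dihedral_op mulr2n addrK. Qed.

Fact dihedral_bij a : bijective (dihedral_op^~ a).
Proof. by exists (dihedral_op^~ a) => x; rewrite /dihedral_op subKr. Qed.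

Fact dihedral_distr a b c :
  dihedral_op (dihedral_op a b) c =
  dihedral_op (dihedral_op a c) (dihedral_op b c).
Proof.
rewrite /dihedral_op mulrnBl [(_ *+ 2 *+ 2)%R]mulr2n !opprB.
move: (c *+ 2)%R (b *+ 2)%R => c2 b2.
by rewrite [RHS]addrC !addrA subrK [(a + _)%R]addrC.
Qed.

HB.instance Definition _ := isQuandle.Build (dihedral m)
  dihedral_nonempty dihedral_idem dihedral_bij dihedral_distr.

End Dihedral.

(* Main.v *)
(** The classes of Z/mZ modulo the subgroups 2^s(Z/mZ) are subquandles.  If any
    two elements of a subquandle differ by an element of 2^s(Z/mZ), then its
    translations x |-> 2b - x = x + 2(b - x) move points within their classes
    modulo 2^(s+1); and in a full class modulo 2^s, one translation carries a to
    any element of its class modulo 2^(s+1).  Hence D^n consists of the classes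
    modulo 2^n, and a connected subquandle lies in one class modulo 2^s for
    every s.  As k is odd, the chain of subgroups is constant from s = l on, so
    the classes modulo 2^l are connected, and they are the maximal ones. *)

Require Import Defs.
From HB Require Import structures.
From mathcomp Require Import all_boot all_algebra.
From mathcomp Require Import boolp classical_sets functions cardinality.

Local Open Scope classical_set_scope.
Local Open Scope card_scope.

Import GRing.Theory.

(** * Cosets of the subgroups 2^s V of an abelian group *)

Definition pow2_class {V : zmodType} (s : nat) (a : V) : set V :=
  [set x | exists t : V, x = (a + t *+ 2 ^ s)%R].

Section Pow2Class.
Context {V : zmodType}.
Implicit Types (s : nat) (a b x y t : V).

Lemma pow2_class_refl s a : pow2_class s a a.
Proof. by exists 0%R; rewrite mul0rn addr0. Qed.

Lemma pow2_class_sym {s a b} : pow2_class s a b -> pow2_class s b a.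
Proof. by move=> [t ->]; exists (- t)%R; rewrite mulNrn addrK. Qed.

Lemma pow2_class_trans {s a b x} :
  pow2_class s a b -> pow2_class s b x -> pow2_class s a x.
Proof. by move=> [t ->] [u ->]; exists (t + u)%R; rewrite mulrnDl addrA. Qed.

Lemma pow2_class0 a : pow2_class 0 a = setT.
Proof.
by apply/seteqP; split=> // x _; exists (x - a)%R; rewrite addrC subrK.
Qed.

Lemma pow2_class_eq {s a b} :
  pow2_class s a b -> pow2_class s a = pow2_class s b.
Proof.
move=> ab; apply/seteqP; split=> x; last exact: pow2_class_trans.
exact/pow2_class_trans/pow2_class_sym.
Qed.

(** If b = x + 2^s t, then 2b - x = x + 2^(s+1) t: reflecting in [b] doubles the displacement. *)
Lemma pow2_class_reflect s b x :
  pow2_class s x b -> pow2_class s.+1 x (b *+ 2 - x)%R.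
Proof.
move=> [t ->]; exists t.
by rewrite mulrnDl mulr2n -mulrnA -expnSr addrAC addrK.
Qed.

(** For y = x + 2^(s+1) t, the midpoint x + 2^s t serves as [b]. *)
Lemma pow2_class_reflect_ex {s x y} :
  pow2_class s.+1 x y -> exists2 b, pow2_class s x b & y = (b *+ 2 - x)%R.
Proof.
move=> [t ->]; exists (x + t *+ 2 ^ s)%R; first by exists t.
by rewrite mulrnDl mulr2n -mulrnA -expnSr addrAC addrK.
Qed.

Lemma pow2_classW {s a x} : pow2_class s.+1 a x -> pow2_class s a x.
Proof. by move=> [t ->]; exists (t *+ 2)%R; rewrite -mulrnA -expnS. Qed.

End Pow2Class.

(** * Equality of subquandles and symmetry of isomorphism *)

Lemma subquandle_eq {X : quandleType} {A B : subquandle X} :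
  (A : set X) = B -> A = B.
Proof.
case: A B => [A A0 Abij] [B B0 Bbij] /= AB; case: B / AB in B0 Bbij *.
by congr Subquandle; apply: Prop_irrelevance.
Qed.

Lemma quandle_isomorphic_sym {X Y : quandleType} :
  quandle_isomorphic X Y -> quandle_isomorphic Y X.
Proof.
move=> [f [g fK gK] fM]; exists g; first by exists f.
by move=> x y; apply: (can_inj fK); rewrite fM !gK.
Qed.

(** * Classes as subquandles of the dihedral quandle, and their orbits *)

Section Classes.
Context {m : nat}.
Local Notation V := ('I_m.-1.+1).
Local Notation D := (dihedral m).

Fact class_nonempty s (a : V) : (pow2_class s a : set D) !=set0.
Proof. by exists a; apply: pow2_class_refl. Qed.

Fact class_bij s (a : V) (c : D) : pow2_class s a c ->
  set_bij (pow2_class s a : set D) (pow2_class s a) (right_translation c).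
Proof.
have homo x b : pow2_class s a b -> pow2_class s a x ->
    pow2_class s a (b *+ 2 - x)%R.
  move=> ab ax; apply: (pow2_class_trans ax).
  apply/pow2_classW/pow2_class_reflect.
  exact: pow2_class_trans (pow2_class_sym ax) ab.
move=> ac; split.
- by move=> x ax; apply: homo.
- by move=> x y _ _; have [g gK _] := qop_bij c; apply: (can_inj gK).
(* Right translations are involutions, so the preimage of [y] is its own reflection. *)
- move=> y ay; exists (c *+ 2 - y : V)%R; first exact: homo.
  by rewrite /right_translation /qop /= /dihedral_op subKr.
Qed.

Definition class_subquandle s (a : V) : subquandle D :=
  Subquandle (class_nonempty s a) (class_bij s a).

(** Each generator reflects in a point of [B] congruent to [x] modulo 2^s; composition and inversion
    preserve the resulting congruence modulo 2^(s+1). *)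
Lemma Inn_pow2_class {B : subquandle D} {s} :
    (forall x y : D, subquandle_set B x -> subquandle_set B y -> pow2_class s (x : V) y) ->
  forall (f : B -> B) (x : B),
  Inn f -> pow2_class s.+1 (val x : V) (val (f x)).
Proof.
move=> Bs f x If; elim: If x => {f} [b x|x|f g _ IHf _ IHg x|f g _ IHf _ gK x].
- by apply: pow2_class_reflect; apply: Bs; apply: set_mem (valP _).
- exact: pow2_class_refl.
- exact: pow2_class_trans (IHg x) (IHf _).
- by apply: pow2_class_sym; rewrite -{2}(gK x); apply: IHf.
Qed.

(** Induction on [s]: an inner automorphism of [B] carries [x] to [y], and it moves points only
    within classes of the next level. *)
Lemma connected_pow2_class (B : subquandle D) : connected_quandle B ->
  forall s (x y : D), subquandle_set B x -> subquandle_set B y -> pow2_class s (x : V) y.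
Proof.
move=> Bconn; elim=> [|s IHs] x y Bx By; first by rewrite pow2_class0.
have [f If fxy] := Bconn (Sub x (mem_set Bx)) (Sub y (mem_set By)).
by have := Inn_pow2_class IHs f (Sub x (mem_set Bx)) If; rewrite fxy.
Qed.

(** One translation suffices: the midpoint [b] of [x] and [y] is congruent to [x] modulo 2^s, so it
    stays in the class of [a]. *)
Lemma class_Inn {s} {a : V} (x y : class_subquandle s a) :
  pow2_class s.+1 (val x : V) (val y) -> exists2 f, Inn f & f x = y.
Proof.
move=> /pow2_class_reflect_ex [b xb yE].
have ab : subquandle_set (class_subquandle s a) b.
  exact: pow2_class_trans (set_mem (valP x)) xb.
exists (right_translation (Sub b (mem_set ab) : class_subquandle s a)).
  exact: Inn_gen.
exact/val_inj/esym.
Qed.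

Lemma orbit_class s (a : V) (x : class_subquandle s a) :
  orbit_subquandle x = class_subquandle s.+1 (val x).
Proof.
apply: subquandle_eq; apply/seteqP; split=> [_ [_ [f If <-] <-]|y xy].
  apply: Inn_pow2_class If => u v au av.
  exact: pow2_class_trans (pow2_class_sym au) av.
have ay : subquandle_set (class_subquandle s a) y.
  exact: pow2_class_trans (set_mem (valP x)) (pow2_classW xy).
have [f If fx] := class_Inn x (Sub y (mem_set ay)) xy.
by exists (Sub y (mem_set ay)) => //; exists f.
Qed.

Lemma orbits_iter_class n : orbits_iter D n = range (class_subquandle n).
Proof.
elim: n => [|n IHn].
  (* At level 0 every class is the whole quandle; the representative 0 is arbitrary. *)
  apply/seteqP; split=> [_ ->|_ [a _ <-]] /=.
    by exists 0%R => //; apply: subquandle_eq; rewrite /= pow2_class0.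
  by apply: subquandle_eq; rewrite /= pow2_class0.
rewrite /orbits_iter iterS -/(orbits_iter D n) IHn.
apply/seteqP; split=> [_ [_ [a _ <-] [x _ <-]]|_ [a _ <-]].
  by exists (val x) => //; rewrite orbit_class.
exists (class_subquandle n a); first by exists a.
exists (Sub a (mem_set (pow2_class_refl n a))) => //.
by rewrite orbit_class.
Qed.

End Classes.

(** * Maximal connected subquandles of R_m for m = 2^l k with k odd *)

Section Decomposition.
Context {m l k : nat} (m_gt0 : 0 < m) (mE : m = 2 ^ l * k) (k_odd : odd k).
Local Notation V := ('I_m.-1.+1).
Local Notation D := (dihedral m).

Lemma k_gt0 : 0 < k. Proof. by case: k k_odd. Qed.

Lemma modn_predK n i : 0 < n -> i %% n.-1.+1 = i %% n.
Proof. by move=> n_gt0; rewrite prednK. Qed.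

Lemma mulrn_order (x : V) : (x *+ m = 0)%R.
Proof. by apply: val_inj; rewrite Zp_mulrn /= modn_predK// modnMl. Qed.

(** As 2^l k = m annihilates Z/m, 2^l t = 2^l (k+1) t = 2^(l+1) ((k+1)/2) t, where k + 1 is even. *)
Lemma pow2_classS_stable (a x : V) : pow2_class l a x -> pow2_class l.+1 a x.
Proof.
move=> [t ->]; exists (t *+ k.+1./2)%R; rewrite -mulrnA expnSr mulnC -mulnA.
have -> : 2 * k.+1./2 = k.+1 by rewrite mul2n even_halfK//= k_odd.
by rewrite mulnS -mE mulrnDr mulrn_order addr0.
Qed.

(** For s <= l, 2^s divides m, so residues modulo 2^s survive reduction modulo m. This turns
    membership in a class into arithmetic of natural numbers. *)
Lemma val_pow2_class s (a x : V) : s <= l ->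
  pow2_class s a x <-> a = x %[mod 2 ^ s].
Proof.
move=> sl; have sm : 2 ^ s %| m.-1.+1.
  by rewrite prednK// mE dvdn_mulr// dvdn_exp2l.
split=> [[t ->]|ax].
  by rewrite Zp_mulrn /= modnDmr modn_dvdm// -modnDmr modnMl addn0.
(* Euclidean division by 2^s: each [y] lies in the class of its remainder, the quotient being the
   witness. *)
have rep (y : V) : pow2_class s (inZp (y %% 2 ^ s)) y.
  exists (inZp (y %/ 2 ^ s)); apply: val_inj; rewrite Zp_mulrn /=.
  by rewrite modnMml modnDm addnC -divn_eq modn_small.
by apply: pow2_class_trans (rep x); rewrite -ax; apply: pow2_class_sym.
Qed.

Lemma class_connected (a : V) :
  connected_quandle (class_subquandle l a : subquandle D).
Proof.
move=> x y; apply: class_Inn; apply: pow2_classS_stable.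
exact: pow2_class_trans (pow2_class_sym (set_mem (valP x))) (set_mem (valP y)).
Qed.

(** A connected subquandle lies in the class modulo 2^l of any of its points, and that class is
    connected; both directions follow. *)
Lemma maximal_connectedP (A : subquandle D) :
  maximal_connected A <-> exists a : V, A = class_subquandle l a.
Proof.
split=> [[Aconn Amax]|[a ->]].
  have [a Aa] := subquandle_nonempty A; exists a; apply/esym/Amax.
    exact: class_connected.
  by move=> x Ax; apply: connected_pow2_class Aa Ax.
split=> [|B Bconn aB]; first exact: class_connected.
apply: subquandle_eq; apply/seteqP; split=> // x Bx.
by apply: connected_pow2_class Bx => //; apply/aB/pow2_class_refl.
Qed.

(** Covering puts every class in [F]: the member of [F] containing [a] is itself a class, hence the
    class of [a]. *)
Lemma maximal_connected_decompositionP (F : set (subquandle D)) :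
  maximal_connected_decomposition F <-> F = range (class_subquandle l).
Proof.
split=> [[Fmax _ Fcover]|->].
  apply/seteqP; split=> [A /Fmax/maximal_connectedP[a ->]|_ [a _ <-]].
    by exists a.
  have [A FA Aa] : (\bigcup_(A in F) (A : set D)) a by rewrite Fcover.
  have /maximal_connectedP[b AE] := Fmax _ FA.
  suff -> : class_subquandle l a = A by [].
  by rewrite AE in Aa *; apply/subquandle_eq/esym/pow2_class_eq.
split=> [_ [a _ <-]||]; first by apply/maximal_connectedP; exists a.
  move=> _ _ [a _ <-] [b _ <-] [x [/= ax bx]].
  by apply: subquandle_eq; rewrite /= (pow2_class_eq ax) (pow2_class_eq bx).
apply/seteqP; split=> // a _; exists (class_subquandle l a); first by exists a.
exact: pow2_class_refl.
Qed.

(** * Counting the classes by their representatives 0, ..., 2^l - 1 *)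

Lemma card_classes :
  range (class_subquandle l : V -> subquandle D) #= `I_(2 ^ l).
Proof.
have le_m : 2 ^ l <= m by rewrite mE leq_pmulr// k_gt0.
have val_inZp i : i < 2 ^ l -> (inZp i : V) = i :> nat.
  by move=> il; rewrite /= modn_small// prednK// (leq_trans il).
have -> : range (class_subquandle l : V -> subquandle D) =
    [set class_subquandle l (inZp i : V) | i in `I_(2 ^ l)].
  apply/seteqP; split=> [_ [a _ <-]|_ [i _ <-]]; last by exists (inZp i).
  have al : a %% 2 ^ l < 2 ^ l by rewrite ltn_mod expn_gt0.
  exists (a %% 2 ^ l) => //; apply/subquandle_eq/pow2_class_eq.
  by apply/val_pow2_class => //; rewrite val_inZp// modn_mod.
apply: inj_card_eq => i j /set_mem il /set_mem jl ij.
have : pow2_class l (inZp i : V) (inZp j).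
  rewrite -[pow2_class _ _]/(subquandle_set (class_subquandle l (inZp i : V))).
  by rewrite ij; apply: pow2_class_refl.
by move=> /val_pow2_class -/(_ (leqnn l)); rewrite !val_inZp// !modn_small.
Qed.

(** * Multiplication by 2^l from Z/k to Z/m, and the isomorphism with R_k *)

Definition scale_pow2 (j : 'I_k.-1.+1) : V := (inZp j *+ 2 ^ l)%R.

Lemma scale_pow2E (j : 'I_k.-1.+1) : scale_pow2 j = 2 ^ l * j :> nat.
Proof.
rewrite /scale_pow2 Zp_mulrn /= modnMml mulnC modn_small// (prednK m_gt0).
have := ltn_ord j; rewrite [X in _ < X]prednK ?k_gt0// => jk.
by rewrite mE ltn_pmul2l// expn_gt0.
Qed.

(** The reduction modulo k hidden in i + j is harmless: 2^l (n mod k) = (2^l n) mod m. *)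
Lemma scale_pow2D : {morph scale_pow2 : i j / (i + j)%R}.
Proof.
move=> i j; apply: val_inj; rewrite /= !scale_pow2E /=.
by rewrite (modn_predK k) ?k_gt0// (modn_predK m)// mE muln_modr mulnDr.
Qed.

Lemma scale_pow2B : {morph scale_pow2 : i j / (i - j)%R}.
Proof.
by move=> i j; apply/esym/eqP; rewrite subr_eq -scale_pow2D subrK.
Qed.

Lemma class_isomorphic (a : V) :
  quandle_isomorphic (class_subquandle l a : subquandle D) (dihedral k).
Proof.
(* The map is built from R_k to the class, as j |-> a + 2^l j, which avoids dividing by 2^l. *)
apply: quandle_isomorphic_sym.
have im (j : 'I_k.-1.+1) :
    subquandle_set (class_subquandle l a) (a + scale_pow2 j)%R by exists (inZp j).
pose g (j : dihedral k) : class_subquandle l a := 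
    Sub (a + scale_pow2 j : D)%R (mem_set (im j)).
have g_inj : injective g.
  move=> i j /(congr1 val) /= /addrI /(congr1 val) /= /eqP.
  by rewrite !scale_pow2E eqn_pmul2l ?expn_gt0// => /eqP/val_inj.
have g_surj y : {x | g x = y}.
  apply: cid; have [t yE] := set_mem (valP y).
  exists (inZp t); apply: val_inj; rewrite /= {}yE; congr (_ + _)%R.
  apply: val_inj; rewrite /= scale_pow2E Zp_mulrn /=.
  by rewrite (modn_predK k) ?k_gt0// (modn_predK m)// muln_modr -mE mulnC.
exists g.
  exists (fun y => sval (g_surj y)) => [x|y]; last by case: (g_surj y).
  by case: (g_surj _) => z /= /g_inj.
move=> i j; apply: val_inj.
(* The operation is an affine combination with coefficients 2 and -1 of sum 1, so translation by [a]
   preserves it. *)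
change (a + scale_pow2 (j *+ 2 - i) =
  (a + scale_pow2 j) *+ 2 - (a + scale_pow2 i))%R.
rewrite scale_pow2B !mulr2n scale_pow2D opprD [RHS]addrACA.
by rewrite [(a + _ - a)%R]addrAC subrr add0r -!addrA addrCA.
Qed.

(** For p < l the class of 0 modulo 2^p contains 2^p; were it connected, 2^p would be congruent to 0
    modulo 2^l. *)
Lemma dihedral_depth : has_depth D l.
Proof.
split=> [|p]; rewrite orbits_iter_class.
  exact/maximal_connected_decompositionP.
move=> [pmax _ _]; rewrite leqNgt; apply/negP => pl.
have [/connected_pow2_class pconn _] : maximal_connected
  (class_subquandle p 0%R : subquandle D) by apply: pmax; exists 0%R.
have p_lt : 2 ^ p < 2 ^ l by rewrite ltn_exp2l.
have pm : 2 ^ p < m by rewrite (leq_trans p_lt)// mE leq_pmulr// k_gt0.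
have val2p : (inZp (2 ^ p) : V) = 2 ^ p :> nat by rewrite /= modn_small// prednK.
have p_class : pow2_class p (0%R : V) (inZp (2 ^ p)).
  by apply/val_pow2_class; rewrite ?(ltnW pl)// val2p modnn mod0n.
have /(val_pow2_class _ _ _ (leqnn l)) :=
  pconn l _ _ (pow2_class_refl _ _) p_class.
by rewrite val2p mod0n modn_small// => /esym/eqP; rewrite expn_eq0.
Qed.

End Decomposition.

Theorem corollary6 (m l k : nat) (m_gt0 : 0 < m) (mE : m = 2 ^ l * k)
    (k_odd : odd k) :
  [/\ (exists F : set (subquandle (dihedral m)),
        maximal_connected_decomposition F),
      (forall F : set (subquandle (dihedral m)),
        maximal_connected_decomposition F -> F #= `I_(2 ^ l)),
      (forall A : subquandle (dihedral m),
        maximal_connected A -> quandle_isomorphic A (dihedral k))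
    & has_depth (dihedral m) l].
Proof.
split.
- exists (range (class_subquandle l)).
  exact/(maximal_connected_decompositionP m_gt0 mE k_odd).
- move=> F /(maximal_connected_decompositionP m_gt0 mE k_odd) ->.
  exact: card_classes m_gt0 mE k_odd.
- move=> A /(maximal_connectedP m_gt0 mE k_odd)[a ->].
  exact: class_isomorphic m_gt0 mE k_odd a.
- exact: dihedral_depth m_gt0 mE k_odd.
Qed.
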